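(* For any integer $m\ge 1$, the equation $\Delta^{2m}u=e^u$ admits no classical entire solution in $\mathbb{R}^2$; that is, there is no function $u\in C^{4m}(\mathbb{R}^2)$ with $\Delta^{2m}u=e^u$ at every point of $\mathbb{R}^2$.
   Context: A classical solution of $\Delta^{\ell}u=f(u)$, with $\ell$ a positive integer, is a solution of class $C^{2\ell}$. ''Entire'' means defined on all of $\mathbb{R}^2$. *)

(* Defs.v *)
From Stdlib Require Import Reals.
From Coquelicot Require Import Coquelicot.

Open Scope R_scope.

(* A function on the plane is curried, as in Coquelicot's [Derive_2d]. *)

Definition laplacian (u : R -> R -> R) (x y : R) : R :=
  partial_derive 2 0 u x y + partial_derive 0 2 u x y.

Definition iter_laplacian (l : nat) (u : R -> R -> R) : R -> R -> R :=
  Nat.iter l laplacian u.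

(* [ex_diff_n u k x y] says that u and all its iterated partial derivatives of
   order at most k exist and are continuous, jointly in the two variables, at
   (x, y). Asking for it at every point is therefore exactly u \in C^k(R^2). *)
Definition class_C (k : nat) (u : R -> R -> R) : Prop :=
  forall x y : R, ex_diff_n u k x y.

(* [partial_derive] is total, but under the C^{2l} hypothesis every derivative
   occurring in the equation is a genuine one. *)
Definition classical_entire_solution
    (l : nat) (f : R -> R) (u : R -> R -> R) : Prop :=
  class_C (2 * l) u /\ forall x y : R, iter_laplacian l u x y = f (u x y).

(* Main.v *)
Require Import Defs.
From Stdlib Require Import Reals Lra Lia.
From Coquelicot Require Import Coquelicot.

(** Let [l >= 1] and suppose that [u] solves [Delta^l u = exp u] on the plane.
    Averaging over circles centred at the origin turns the equation into a
    chain of one-variable inequalities that forces blow-up at a finite radius.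

    The radius is written [exp t]. In the coordinates [(t, theta)] the Laplacian
    is [exp (- 2 t)] times the flat Laplacian in [t] and [theta], and the
    [theta]-part has mean zero over a circle, so the mean [p k t] of
    [Delta^k u] over the circle of radius [exp t] satisfies
    [p k '' = exp (2 t) * p (k + 1)] for all real [t], with no singularity to
    treat at the origin ([is_derive_circle_mean],
    [is_derive_circle_mean_radial]). Jensen's inequality closes the chain:
    [p l >= exp (p 0)] ([exp_circle_mean_le]).

    Since [p l > 0], the function [p (l - 1)] is strictly convex in [t]. It is
    bounded above as [t] tends to minus infinity, where the circles shrink to the
    origin, hence its derivative is positive, and [p (l - 1)] tends to
    infinity. This is where dimension two enters: convexity in the logarithm
    of the radius makes the mean grow at least like that logarithm. Going
    down the chain, every [p k] tends to infinity and is increasing for large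
    [t] ([q_eventually_positive], [all_eventually_nonneg]).

    From there on, integrating the [2 l] inequalities of the chain, each over
    an interval of length [h], gives
    [p 0 (s + 2 l h) >= h ^ (2 l) * exp (p 0 s)] ([growth_step]). Taking for
    [h] the successive powers of [exp (-1)] makes [p 0] tend to infinity along
    a bounded sequence of points, which is absurd for a nondecreasing
    function defined on the whole line ([no_accelerating_growth]). *)

Open Scope R_scope.

(** * Functions with continuous first partial derivatives *)

Definition continuous_plane (g : R -> R -> R) : Prop :=
  forall x y : R, continuity_2d_pt g x y.

Definition C1_partials (g gx gy : R -> R -> R) : Prop :=
  (forall x y, is_derive (fun z => g z y) x (gx x y)) /\
  (forall x y, is_derive (fun z => g x z) y (gy x y)) /\
  continuous_plane gx /\ continuous_plane gy.

(** Continuity of the partial derivatives upgrades them to a total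
    differential, which is what a chain rule along a curve needs. *)
Lemma C1_chain (g gx gy : R -> R -> R) (a b : R -> R) (t da db : R) :
  C1_partials g gx gy -> is_derive a t da -> is_derive b t db ->
  is_derive (fun s => g (a s) (b s)) t (gx (a t) (b t) * da + gy (a t) (b t) * db).
Proof.
  intros (Hx & Hy & Cx & Cy) Ha Hb.
  apply is_derive_Reals.
  apply derivable_pt_lim_comp_2d; try now apply is_derive_Reals.
  apply filterdiff_differentiable_pt_lim.
  apply is_derive_filterdiff with (dfx := gx).
  - apply filter_forall; intros [x y]; apply Hx.
  - apply Hy.
  - apply (proj1 (continuity_2d_pt_filterlim gx (a t) (b t))), Cx.
Qed.

Lemma C1_continuous (g gx gy : R -> R -> R) :
  C1_partials g gx gy -> continuous_plane g.
Proof.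
  intros (Hx & Hy & Cx & Cy) x y.
  apply differentiable_continuity_pt.
  exists (gx x y), (gy x y).
  apply filterdiff_differentiable_pt_lim.
  apply is_derive_filterdiff with (dfx := gx).
  - apply filter_forall; intros [x' y']; apply Hx.
  - apply Hy.
  - apply (proj1 (continuity_2d_pt_filterlim gx x y)), Cx.
Qed.

(** * Means over circles of radius [exp t] *)

Definition polar_pullback (g : R -> R -> R) (t theta : R) : R :=
  g (exp t * cos theta) (exp t * sin theta).

Lemma polar_pullback_continuous (g : R -> R -> R) :
  continuous_plane g -> continuous_plane (polar_pullback g).
Proof.
  intros Hg t th.
  assert (Ce : continuity_2d_pt (fun s _ => exp s) t th).
  { apply (continuity_1d_2d_pt_comp exp (fun s _ => s)).
    apply derivable_continuous, derivable_exp. apply continuity_2d_pt_id1. }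
  assert (Cc : continuity_2d_pt (fun _ a => cos a) t th).
  { apply (continuity_1d_2d_pt_comp cos (fun _ a => a)).
    apply continuity_cos. apply continuity_2d_pt_id2. }
  assert (Cs : continuity_2d_pt (fun _ a => sin a) t th).
  { apply (continuity_1d_2d_pt_comp sin (fun _ a => a)).
    apply continuity_sin. apply continuity_2d_pt_id2. }
  pose proof (continuity_2d_pt_mult _ _ _ _ Ce Cc) as Cx.
  pose proof (continuity_2d_pt_mult _ _ _ _ Ce Cs) as Cy.
  apply continuity_2d_pt_filterlim in Cx.
  apply continuity_2d_pt_filterlim in Cy.
  apply continuity_2d_pt_filterlim.
  apply filterlim_comp_2 with (1 := Cx) (2 := Cy) (h := g).
  pose proof (Hg (exp t * cos th) (exp t * sin th)) as Cg.
  apply continuity_2d_pt_filterlim in Cg.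
  intros P HP. specialize (Cg P HP).
  destruct Cg as [e He].
  exists (ball (exp t * cos th) e) (ball (exp t * sin th) e).
  now exists e. now exists e.
  intros x y Hx Hy. apply (He (x, y)). now split.
Qed.

Lemma continuous_plane_snd (g : R -> R -> R) (t th : R) :
  continuous_plane g -> continuous (g t) th.
Proof.
  intros Hg. apply continuity_pt_filterlim.
  intros eps Heps.
  destruct (Hg t th (mkposreal eps Heps)) as [d Hd].
  exists d; split. apply d.
  intros x [_ Hx]. apply Hd; trivial.
  rewrite Rminus_eq_0, Rabs_R0. apply d.
Qed.

Lemma ex_RInt_circle (g : R -> R -> R) (t a b : R) :
  continuous_plane g -> ex_RInt (polar_pullback g t) a b.
Proof.
  intros Hg. apply (@ex_RInt_continuous R_CompleteNormedModule).
  intros z _. apply continuous_plane_snd. now apply polar_pullback_continuous.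
Qed.

Definition circle_mean (g : R -> R -> R) (t : R) : R :=
  / (2 * PI) * RInt (polar_pullback g t) 0 (2 * PI).

(** [radial gx gy] and [angular gx gy] are the vector fields [x d/dx + y d/dy] and
    [x d/dy - y d/dx] applied to a function with partial derivatives [gx] and
    [gy]. They represent differentiation in [t] and in [theta]. *)
Definition radial (gx gy : R -> R -> R) (x y : R) : R := x * gx x y + y * gy x y.
Definition angular (gx gy : R -> R -> R) : R -> R -> R := radial gy (fun x y => - gx x y).

Lemma is_derive_pullback_t (g gx gy : R -> R -> R) (t th : R) :
  C1_partials g gx gy ->
  is_derive (fun s => polar_pullback g s th) t (polar_pullback (radial gx gy) t th).
Proof.
  intros H. unfold polar_pullback, radial.
  replace (_ + _) with
    (gx (exp t * cos th) (exp t * sin th) * (exp t * cos th)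
     + gy (exp t * cos th) (exp t * sin th) * (exp t * sin th)) by ring.
  apply (C1_chain g gx gy (fun s => exp s * cos th) (fun s => exp s * sin th));
    trivial; auto_derive; trivial; ring.
Qed.

Lemma is_derive_pullback_theta (g gx gy : R -> R -> R) (t th : R) :
  C1_partials g gx gy ->
  is_derive (polar_pullback g t) th (polar_pullback (angular gx gy) t th).
Proof.
  intros H. unfold polar_pullback, angular, radial.
  replace (_ + _) with
    (gx (exp t * cos th) (exp t * sin th) * (- (exp t * sin th))
     + gy (exp t * cos th) (exp t * sin th) * (exp t * cos th)) by ring.
  apply (C1_chain g gx gy (fun s => exp t * cos s) (fun s => exp t * sin s));
    trivial; auto_derive; trivial; ring.
Qed.

Lemma continuous_plane_radial (gx gy : R -> R -> R) :
  continuous_plane gx -> continuous_plane gy -> continuous_plane (radial gx gy).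
Proof.
  intros Hx Hy x y. unfold radial.
  apply continuity_2d_pt_plus; apply continuity_2d_pt_mult; auto using
   continuity_2d_pt_id1, continuity_2d_pt_id2.
Qed.

Lemma continuous_plane_opp (g : R -> R -> R) :
  continuous_plane g -> continuous_plane (fun x y => - g x y).
Proof. intros H x y. now apply continuity_2d_pt_opp. Qed.

Lemma continuous_plane_angular (gx gy : R -> R -> R) :
  continuous_plane gx -> continuous_plane gy -> continuous_plane (angular gx gy).
Proof.
  intros Hx Hy. apply continuous_plane_radial; trivial. now apply continuous_plane_opp.
Qed.

Lemma is_derive_circle_mean (g gx gy : R -> R -> R) (t : R) :
  C1_partials g gx gy ->
  is_derive (circle_mean g) t (circle_mean (radial gx gy) t).
Proof.
  intros H. unfold circle_mean.
  apply (is_derive_scal (fun s => RInt (polar_pullback g s) 0 (2 * PI))).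
  rewrite (RInt_ext (polar_pullback (radial gx gy) t)
            (fun th => Derive (fun s => polar_pullback g s th) t)).
  2:{ intros th _. symmetry. apply is_derive_unique.
      now apply is_derive_pullback_t. }
  apply (is_derive_RInt_param (polar_pullback g)).
  - apply filter_forall. intros s th _. eexists. now apply (is_derive_pullback_t _ gx gy).
  - intros th _.
    apply (continuity_2d_pt_ext (polar_pullback (radial gx gy))).
    + intros s a. symmetry. apply is_derive_unique. now apply is_derive_pullback_t.
    + apply polar_pullback_continuous, continuous_plane_radial; apply H.
  - apply filter_forall. intros s. apply ex_RInt_circle.
    exact (C1_continuous _ _ _ H).
Qed.

(** The integral of a [theta]-derivative over a full period vanishes. *)
Lemma circle_mean_angular (g gx gy : R -> R -> R) (t : R) :
  C1_partials g gx gy -> circle_mean (angular gx gy) t = 0.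
Proof.
  intros H. unfold circle_mean.
  rewrite (is_RInt_unique _ _ _ (minus (polar_pullback g t (2 * PI)) (polar_pullback g t 0))).
  - unfold polar_pullback. rewrite cos_2PI, sin_2PI, cos_0, sin_0.
    rewrite minus_eq_zero. apply Rmult_0_r.
  - apply (@is_RInt_derive R_CompleteNormedModule).
    + intros th _. now apply is_derive_pullback_theta.
    + intros th _. apply continuous_plane_snd, polar_pullback_continuous,
        continuous_plane_angular; apply H.
Qed.

Lemma C1_radial (ux uy uxx uxy uyx uyy : R -> R -> R) :
  C1_partials ux uxx uxy -> C1_partials uy uyx uyy ->
  C1_partials (radial ux uy)
    (fun x y => ux x y + radial uxx uyx x y)
    (fun x y => uy x y + radial uxy uyy x y).
Proof.
  intros Hx Hy.
  pose proof (C1_continuous _ _ _ Hx) as Cx.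
  pose proof (C1_continuous _ _ _ Hy) as Cy.
  destruct Hx as (Hxx & Hxy & Cxx & Cxy).
  destruct Hy as (Hyx & Hyy & Cyx & Cyy).
  split; [|split; [|split]].
  - intros x y. unfold radial.
    assert (E : is_derive (fun z => z * ux z y + y * uy z y) x
                  (1 * ux x y + x * uxx x y + y * uyx x y)).
    { apply (is_derive_plus (fun z => z * ux z y) (fun z => y * uy z y)).
      - apply (is_derive_mult (fun z => z) (fun z => ux z y)); trivial.
        apply (is_derive_id (K := R_AbsRing)). intros; apply Rmult_comm.
      - apply (is_derive_scal (fun z => uy z y)). apply Hyx. }
    replace (_ + (_ + _)) with (1 * ux x y + x * uxx x y + y * uyx x y) by ring.
    exact E.
  - intros x y. unfold radial.
    assert (E : is_derive (fun z => x * ux x z + z * uy x z) y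
                  (x * uxy x y + (1 * uy x y + y * uyy x y))).
    { apply (is_derive_plus (fun z => x * ux x z) (fun z => z * uy x z)).
      - apply (is_derive_scal (fun z => ux x z)). apply Hxy.
      - apply (is_derive_mult (fun z => z) (fun z => uy x z)); trivial.
        apply (is_derive_id (K := R_AbsRing)). intros; apply Rmult_comm. }
    replace (_ + (_ + _)) with (x * uxy x y + (1 * uy x y + y * uyy x y)) by ring.
    exact E.
  - intros x y. apply continuity_2d_pt_plus; trivial. now apply continuous_plane_radial.
  - intros x y. apply continuity_2d_pt_plus; trivial. now apply continuous_plane_radial.
Qed.

Lemma C1_angular (ux uy uxx uxy uyx uyy : R -> R -> R) :
  C1_partials ux uxx uxy -> C1_partials uy uyx uyy ->
  C1_partials (angular ux uy)
    (fun x y => uy x y + angular uxx uyx x y)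
    (fun x y => - ux x y + angular uxy uyy x y).
Proof.
  intros (Hxx & Hxy & Cxx & Cxy) Hy.
  apply (C1_radial uy (fun x y => - ux x y) uyx uyy
           (fun x y => - uxx x y) (fun x y => - uxy x y)); trivial.
  split; [|split; [|split]].
  - intros x y. apply (is_derive_opp (fun z => ux z y)), Hxx.
  - intros x y. apply (is_derive_opp (fun z => ux x z)), Hxy.
  - now apply continuous_plane_opp.
  - now apply continuous_plane_opp.
Qed.

(** The sum of the squares of the radial and the angular field is
    [x^2 + y^2] times the Laplacian, and the angular part has mean zero. In that
    sum the terms in [uxy] cancel among themselves, and so do those in [uyx]. *)
Lemma is_derive_circle_mean_radial (ux uy uxx uxy uyx uyy : R -> R -> R) (t : R) :
  C1_partials ux uxx uxy -> C1_partials uy uyx uyy ->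
  is_derive (circle_mean (radial ux uy)) t
    (exp (2 * t) * circle_mean (fun x y => uxx x y + uyy x y) t).
Proof.
  intros Hx Hy.
  pose proof (C1_radial _ _ _ _ _ _ Hx Hy) as HR.
  pose proof (C1_angular _ _ _ _ _ _ Hx Hy) as HA.
  pose proof (is_derive_circle_mean _ _ _ t HR) as D.
  pose proof (circle_mean_angular _ _ _ t HA) as Z.
  replace (exp (2 * t) * circle_mean (fun x y => uxx x y + uyy x y) t)
    with (circle_mean (radial (fun x y => ux x y + radial uxx uyx x y)
                              (fun x y => uy x y + radial uxy uyy x y)) t); trivial.
  rewrite <- Rplus_0_r at 1. rewrite <- Z at 1.
  unfold circle_mean. rewrite <- Rmult_plus_distr_l.
  rewrite <- Rmult_assoc, (Rmult_comm (exp _)), Rmult_assoc. f_equal.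
  destruct HR as (_ & _ & CR1 & CR2). destruct HA as (_ & _ & CA1 & CA2).
  rewrite <- (RInt_plus (V := R_CompleteNormedModule));
    try (apply ex_RInt_circle;
         (now apply continuous_plane_radial) || (now apply continuous_plane_angular)).
  destruct Hx as (_ & _ & Cxx & _). destruct Hy as (_ & _ & _ & Cyy).
  rewrite <- (RInt_scal (V := R_CompleteNormedModule)).
  2:{ apply ex_RInt_circle. intros x y. now apply continuity_2d_pt_plus. }
  apply RInt_ext. intros th _.
  unfold polar_pullback, plus, scal, angular, radial; simpl.
  unfold mult; simpl.
  set (a := exp t * cos th). set (b := exp t * sin th).
  assert (Hr : exp (2 * t) = a * a + b * b).
  { replace (2 * t) with (t + t) by ring. rewrite exp_plus. unfold a, b.
    pose proof (sin2_cos2 th) as S. unfold Rsqr in S.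
    replace (exp t * cos th * (exp t * cos th) + exp t * sin th * (exp t * sin th))
      with (exp t * exp t * (sin th * sin th + cos th * cos th)) by ring.
    rewrite S. ring. }
  rewrite Hr. ring.
Qed.

Lemma circle_mean_ext (f g : R -> R -> R) (t : R) :
  (forall x y, f x y = g x y) -> circle_mean f t = circle_mean g t.
Proof.
  intros E. unfold circle_mean. f_equal. apply RInt_ext. intros th _. apply E.
Qed.

Lemma circle_mean_le (f g : R -> R -> R) (t : R) :
  continuous_plane f -> continuous_plane g ->
  (forall th, polar_pullback f t th <= polar_pullback g t th) ->
  circle_mean f t <= circle_mean g t.
Proof.
  intros Cf Cg H. pose proof PI_RGT_0.
  apply Rmult_le_compat_l.
  - apply Rlt_le, Rinv_0_lt_compat. lra.
  - apply RInt_le; auto using ex_RInt_circle. lra.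
Qed.

Lemma continuous_plane_affine (f : R -> R -> R) (a b : R) :
  continuous_plane f -> continuous_plane (fun x y => a * f x y + b).
Proof.
  intros Cf x y. apply continuity_2d_pt_plus; [apply continuity_2d_pt_mult|];
    auto using continuity_2d_pt_const.
Qed.

Lemma circle_mean_affine (f : R -> R -> R) (a b t : R) :
  continuous_plane f ->
  circle_mean (fun x y => a * f x y + b) t = a * circle_mean f t + b.
Proof.
  intros Cf. unfold circle_mean. pose proof PI_RGT_0.
  rewrite (RInt_ext _ (fun th => plus (scal a (polar_pullback f t th)) b)).
  2:{ intros; reflexivity. }
  rewrite (RInt_plus (V := R_CompleteNormedModule)).
  rewrite (RInt_scal (V := R_CompleteNormedModule)), RInt_const.
  unfold plus, scal; simpl; unfold mult; simpl. field. lra.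
  - now apply ex_RInt_circle.
  - apply (ex_RInt_scal (V := R_CompleteNormedModule)). now apply ex_RInt_circle.
  - apply ex_RInt_const.
Qed.

(** Jensen's inequality for [exp], from the tangent line of [exp] at the mean. *)
Lemma exp_circle_mean_le (f : R -> R -> R) (t : R) :
  continuous_plane f ->
  exp (circle_mean f t) <= circle_mean (fun x y => exp (f x y)) t.
Proof.
  intros Cf. set (M := circle_mean f t).
  replace (exp M) with (circle_mean (fun x y => exp M * f x y + exp M * (1 - M)) t).
  2:{ rewrite circle_mean_affine by trivial. fold M. ring. }
  apply circle_mean_le.
  - now apply continuous_plane_affine.
  - intros x y. apply continuity_1d_2d_pt_comp. apply derivable_continuous, derivable_exp.
    apply Cf.
  - intros th. unfold polar_pullback.
    set (v := f _ _).
    replace (exp v) with (exp M * exp (v - M)) by (rewrite <- exp_plus; f_equal; ring).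
    pose proof (exp_ineq1_le (v - M)). pose proof (exp_pos M). nra.
Qed.

Definition bounded_above_at_minus_infinity (f : R -> R) : Prop :=
  exists T M, forall t, t <= T -> f t <= M.

(** As [t] tends to minus infinity the circle shrinks to the origin, where [f] is
    continuous. *)
Lemma circle_mean_bounded_above (f : R -> R -> R) :
  continuous_plane f ->
  bounded_above_at_minus_infinity (circle_mean f).
Proof.
  intros Cf.
  destruct (Cf 0 0 (mkposreal 1 Rlt_0_1)) as [d Hd]. simpl in Hd.
  pose proof (cond_pos d) as Hpos.
  exists (ln (d / 2)), (f 0 0 + 1). intros t Ht.
  assert (He : exp t < d).
  { apply Rle_lt_trans with (exp (ln (d / 2))).
    - destruct Ht as [Ht| ->]. apply Rlt_le, exp_increasing, Ht. apply Rle_refl.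
    - rewrite exp_ln; lra. }
  replace (f 0 0 + 1) with (circle_mean (fun x y => 0 * f x y + (f 0 0 + 1)) t).
  2:{ rewrite circle_mean_affine by trivial. ring. }
  apply circle_mean_le; trivial.
  - now apply continuous_plane_affine.
  - intros th. unfold polar_pullback.
    assert (B : Rabs (f (exp t * cos th) (exp t * sin th) - f 0 0) < 1).
    { pose proof (exp_pos t).
      apply Hd; rewrite Rminus_0_r, Rabs_mult, (Rabs_pos_eq (exp t)) by lra;
      apply Rle_lt_trans with (exp t * 1); try lra; apply Rmult_le_compat_l; try lra;
      apply Rabs_le; [apply COS_bound | apply SIN_bound]. }
    apply Rabs_lt_between in B. lra.
Qed.

(** * Iterated Laplacians of functions of class C^k *)

Lemma class_C_plus (n : nat) (f g : R -> R -> R) :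
  class_C n f -> class_C n g -> class_C n (fun x y => f x y + g x y).
Proof.
  revert f g. induction n as [|n IH]; intros f g Hf Hg x y.
  - split; trivial. apply continuity_2d_pt_plus; [apply Hf | apply Hg].
  - destruct (Hf x y) as (Cf & Dfx & Dfy & _).
    destruct (Hg x y) as (Cg & Dgx & Dgy & _).
    split; [|split; [|split; [|split]]].
    + now apply continuity_2d_pt_plus.
    + now apply (ex_derive_plus (fun z => f z y) (fun z => g z y)).
    + now apply (ex_derive_plus (fun z => f x z) (fun z => g x z)).
    + apply ex_diff_n_ext_loc with
        (fun u v => Derive (fun z => f z v) u + Derive (fun z => g z v) u).
      * apply locally_2d_forall. intros u v. symmetry.
        apply Derive_plus; [apply (Hf u v) | apply (Hg u v)].
      * apply (IH (fun u v => Derive (fun z => f z v) u)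
                  (fun u v => Derive (fun z => g z v) u));
          intros u v; [apply (Hf u v) | apply (Hg u v)].
    + apply ex_diff_n_ext_loc with
        (fun u v => Derive (fun z => f u z) v + Derive (fun z => g u z) v).
      * apply locally_2d_forall. intros u v. symmetry.
        apply Derive_plus; [apply (Hf u v) | apply (Hg u v)].
      * apply (IH (fun u v => Derive (fun z => f u z) v)
                  (fun u v => Derive (fun z => g u z) v));
          intros u v; [apply (Hf u v) | apply (Hg u v)].
Qed.

Definition dx (f : R -> R -> R) (x y : R) : R := Derive (fun z => f z y) x.
Definition dy (f : R -> R -> R) (x y : R) : R := Derive (fun z => f x z) y.

Lemma class_C_continuous (n : nat) (f : R -> R -> R) : class_C n f -> continuous_plane f.
Proof.
  intros H x y. destruct n; apply (H x y).
Qed.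

Lemma class_C_dx (n : nat) (f : R -> R -> R) : class_C (S n) f -> class_C n (dx f).
Proof. intros H x y. apply (H x y). Qed.

Lemma class_C_dy (n : nat) (f : R -> R -> R) : class_C (S n) f -> class_C n (dy f).
Proof. intros H x y. apply (H x y). Qed.

Lemma class_C_C1 (n : nat) (f : R -> R -> R) : class_C (S n) f -> C1_partials f (dx f) (dy f).
Proof.
  intros H. split; [|split; [|split]].
  - intros x y. apply Derive_correct, (H x y).
  - intros x y. apply Derive_correct, (H x y).
  - eapply class_C_continuous, class_C_dx, H.
  - eapply class_C_continuous, class_C_dy, H.
Qed.

Lemma class_C_laplacian (n : nat) (f : R -> R -> R) : class_C (S (S n)) f -> class_C n (laplacian f).
Proof.
  intros H. apply (class_C_plus n (dx (dx f)) (dy (dy f))).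
  - now apply class_C_dx, class_C_dx.
  - now apply class_C_dy, class_C_dy.
Qed.

Lemma class_C_iter_laplacian (l k : nat) (f : R -> R -> R) :
  (k <= l)%nat -> class_C (2 * l) f -> class_C (2 * (l - k)) (iter_laplacian k f).
Proof.
  intros Hk H. induction k as [|k IH].
  - now rewrite Nat.sub_0_r.
  - apply class_C_laplacian.
    replace (S (S (2 * (l - S k)))) with (2 * (l - k))%nat by lia. apply IH. lia.
Qed.

(** * Growth of functions on the line *)

Lemma increment_ge (f f' : R -> R) (a b c : R) :
  (forall t, is_derive f t (f' t)) -> a <= b ->
  (forall t, a <= t <= b -> c <= f' t) -> f a + c * (b - a) <= f b.
Proof.
  intros D Hab Hc.
  destruct (MVT_gen f a b f') as (x & Hx & E).
  - intros x _. apply D.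
  - intros x _. apply continuity_pt_filterlim.
    apply (@ex_derive_continuous _ R_NormedModule f x). eexists. apply D.
  - rewrite Rmin_left, Rmax_right in Hx by lra.
    specialize (Hc x Hx). nra.
Qed.

Lemma tends_to_infinity (f f' : R -> R) (c : R) :
  (forall t, is_derive f t (f' t)) -> 0 < c ->
  Rbar_locally p_infty (fun t => c <= f' t) ->
  forall B, Rbar_locally p_infty (fun t => B <= f t).
Proof.
  intros D Hc [T HT] B.
  exists (T + 1 + Rabs (B - f (T + 1)) / c). intros t Ht.
  assert (Hd : 0 <= Rabs (B - f (T + 1)) / c).
  { apply Rdiv_le_0_compat; trivial. apply Rabs_pos. }
  pose proof (increment_ge f f' (T + 1) t c D) as I.
  specialize (I ltac:(lra) ltac:(intros s Hs; apply HT; lra)).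
  pose proof (Rle_abs (B - f (T + 1))).
  assert (E : c * (Rabs (B - f (T + 1)) / c) = Rabs (B - f (T + 1))) by (field; lra).
  nra.
Qed.

(** A convex function that decreases somewhere lies above a decreasing line
    to the left of that point, so it is unbounded there. *)
Lemma convex_bounded_at_minus_infinity (f f' f'' : R -> R) (T M : R) :
  (forall t, is_derive f t (f' t)) -> (forall t, is_derive f' t (f'' t)) ->
  (forall t, 0 < f'' t) -> (forall t, t <= T -> f t <= M) ->
  (forall s t, s < t -> f' s < f' t) /\ (forall t, 0 < f' t).
Proof.
  intros D D' H'' HM.
  assert (Incr : forall s t, s < t -> f' s < f' t).
  { intros s t Hst. apply (incr_function f' m_infty p_infty f''); simpl; trivial.
    intros x _ _. apply H''. }
  split; trivial.
  assert (Nonneg : forall t, 0 <= f' t).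
  { intros t.
    destruct (Rle_lt_dec 0 (f' t)) as [|Hneg]; trivial. exfalso.
    (* Far enough to the left, the line of slope [f' t] through [(t, f t)]
       exceeds the bound [M]. *)
    set (s := Rmin T (t - (Rabs (M - f t) + 1) / - f' t)).
    assert (Hs : s <= t - (Rabs (M - f t) + 1) / - f' t) by apply Rmin_r.
    assert (Hp : 0 <= (Rabs (M - f t) + 1) / - f' t).
    { apply Rdiv_le_0_compat; [|lra]. pose proof (Rabs_pos (M - f t)). lra. }
    pose proof (increment_ge (fun x => - f x) (fun x => - f' x) s t (- f' t)) as I.
    specialize (I ltac:(intros x; apply (is_derive_opp f), D) ltac:(lra)).
    specialize (I ltac:(intros x [_ [Hx| ->]]; [specialize (Incr x t Hx)|]; lra)).
    cbv beta in I.
    pose proof (HM s (Rmin_l _ _)).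
    pose proof (Rle_abs (M - f t)).
    assert (E : (- f' t) * ((Rabs (M - f t) + 1) / - f' t) = Rabs (M - f t) + 1)
      by (field; lra).
    nra. }
  intros t. apply Rle_lt_trans with (1 := Nonneg (t - 1)). apply Incr. lra.
Qed.

Lemma pow_exp (c : R) (k : nat) : exp c ^ k = exp (INR k * c).
Proof.
  induction k as [|k IH].
  - simpl. now rewrite Rmult_0_l, exp_0.
  - rewrite S_INR, <- tech_pow_Rmult, IH, <- exp_plus. f_equal. ring.
Qed.

(** From a value of at least [K + (n + 1) i], a step [h = exp (- i)] costs a factor
    [h ^ n = exp (- n i)] and leaves [exp (K + i)], which exceeds
    [K + (n + 1) (i + 1)]. The values tend to infinity while the steps have a
    finite sum, so they all stay below a fixed value of [g]. The constant
    [K = 2 (n + 1)] is chosen so that [exp K >= K + n + 1]. *)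
Lemma no_accelerating_growth (n : nat) (g : R -> R) (a : R) :
  (forall s t, a <= s -> s <= t -> g s <= g t) ->
  (forall s h, a <= s -> 0 < h -> h ^ n * exp (g s) <= g (s + INR n * h)) ->
  g a < 2 * (INR n + 1).
Proof.
  intros Mono Hstep.
  set (K := 2 * (INR n + 1)).
  destruct (Rlt_le_dec (g a) K) as [|HK]; trivial. exfalso.
  pose proof (pos_INR n) as Hn.
  set (q := exp (- 1)).
  assert (Hq : 0 < q < 1).
  { split. apply exp_pos. rewrite <- exp_0. apply exp_increasing. lra. }
  set (x := fun i : nat => a + INR n * ((1 - q ^ i) / (1 - q))).
  assert (P : forall i, 0 < q ^ i <= 1).
  { intros i. split. apply pow_lt; lra.
    rewrite <- (pow1 i). apply pow_incr. lra. }
  assert (Hx : forall i, a <= x i <= a + INR n * (1 / (1 - q))).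
  { intros i. unfold x. specialize (P i). split.
    - assert (0 <= (1 - q ^ i) / (1 - q)) by (apply Rdiv_le_0_compat; lra). nra.
    - apply Rplus_le_compat_l, Rmult_le_compat_l; trivial.
      apply Rmult_le_compat_r; [apply Rlt_le, Rinv_0_lt_compat|]; lra. }
  assert (G : forall i, K + (INR n + 1) * INR i <= g (x i)).
  { induction i as [|i IH].
    - replace (x 0%nat) with a by (unfold x; simpl; field; lra). simpl. lra.
    - specialize (Hstep (x i) (q ^ i) (proj1 (Hx i)) (proj1 (P i))).
      replace (x i + INR n * q ^ i) with (x (S i)) in Hstep.
      2:{ unfold x. simpl. field. lra. }
      apply Rle_trans with (2 := Hstep).
      apply Rle_trans with (exp K * exp (INR i)).
      + pose proof (exp_ineq1_le (INR i)). pose proof (pos_INR i).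
        assert (exp K >= K + INR n + 1).
        { replace K with (K / 2 + K / 2) at 1 by field. rewrite exp_plus.
          pose proof (exp_ineq1_le (K / 2)). unfold K in *. nra. }
        rewrite S_INR. unfold K in *. nra.
      + unfold q. rewrite !pow_exp, <- !exp_plus.
        assert (M : INR n * (INR i * -1) + (K + (INR n + 1) * INR i) <=
                INR n * (INR i * -1) + g (x i)) by lra.
        replace (K + INR i) with (INR n * (INR i * -1) + (K + (INR n + 1) * INR i)) by ring.
        destruct M as [M| ->]; [apply Rlt_le, exp_increasing, M | apply Rle_refl]. }
  set (b := a + INR n * (1 / (1 - q))) in *.
  destruct (INR_unbounded (g b)) as [i Hi].
  specialize (G i). pose proof (Mono (x i) b (proj1 (Hx i)) (proj2 (Hx i))).
  pose proof (pos_INR i). unfold K in G. nra.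
Qed.

(** * Blow-up for the chain of means *)

(** The chain of equations satisfied by the circle means [p k] of [Delta^k u],
    with [q k] the derivative of [p k]. It is stated for arbitrary functions because
    the contradiction only concerns ordinary differential inequalities. *)
Definition log_radial_chain (l : nat) (p q : nat -> R -> R) : Prop :=
  (forall k t, (k < l)%nat -> is_derive (p k) t (q k t)) /\
  (forall k t, (k < l)%nat -> is_derive (q k) t (exp (2 * t) * p (S k) t)) /\
  (forall t, exp (p 0%nat t) <= p l t).

(** The top of the chain is where the behaviour at the origin is used: without
    the bound to the left, [p (l - 1)] could decrease. *)
Lemma q_top_eventually_positive (l : nat) (p q : nat -> R -> R) :
  (1 <= l)%nat -> log_radial_chain l p q ->
  bounded_above_at_minus_infinity (p (l - 1)%nat) ->
  exists c, 0 < c /\ Rbar_locally p_infty (fun t => c <= q (l - 1)%nat t).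
Proof.
  intros Hl (Dp & Dq & Top) (T & M & HM).
  destruct (convex_bounded_at_minus_infinity (p (l - 1)%nat) (q (l - 1)%nat)
              (fun t => exp (2 * t) * p l t) T M) as [Incr Pos]; trivial.
  - intros t. apply Dp. lia.
  - intros t. replace l with (S (l - 1)) at 2 by lia. apply Dq. lia.
  - intros t. apply Rmult_lt_0_compat; [apply exp_pos|].
    apply Rlt_le_trans with (2 := Top t). apply exp_pos.
  - exists (q (l - 1)%nat 0). split; auto.
    exists 0. intros t Ht. now apply Rlt_le, Incr.
Qed.

(** Positivity passes down the chain: once [q (k + 1)] is bounded below by a
    positive constant, [p (k + 1)] tends to infinity, and since it drives the
    growth of [q k], so does [q k]. The index counts from the top. *)
Lemma q_eventually_positive (l : nat) (p q : nat -> R -> R) (j : nat) :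
  log_radial_chain l p q -> bounded_above_at_minus_infinity (p (l - 1)%nat) ->
  (j < l)%nat ->
  exists c, 0 < c /\ Rbar_locally p_infty (fun t => c <= q (l - 1 - j)%nat t).
Proof.
  intros Ch Bd. induction j as [|j IH]; intros Hj.
  - rewrite Nat.sub_0_r. now apply (q_top_eventually_positive l p q).
  - destruct (IH ltac:(lia)) as (c & Hc & Ev).
    exists 1. split; [lra|].
    apply (tends_to_infinity _ (fun t => exp (2 * t) * p (l - 1 - j)%nat t) 1).
    + intros t. replace (l - 1 - j)%nat with (S (l - 1 - S j)) by lia. apply Ch. lia.
    + lra.
    + assert (Ev1 : Rbar_locally p_infty (fun t => 1 <= p (l - 1 - j)%nat t)).
      { apply (tends_to_infinity _ (q (l - 1 - j)%nat) c); trivial.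
        intros t. apply Ch. lia. }
      destruct Ev1 as [T1 HT1]. exists (Rmax T1 0). intros t Ht.
      pose proof (Rmax_l T1 0). pose proof (Rmax_r T1 0).
      specialize (HT1 t ltac:(lra)). pose proof (exp_ineq1_le (2 * t)). nra.
Qed.

Lemma all_eventually_nonneg (l : nat) (p q : nat -> R -> R) (k : nat) :
  log_radial_chain l p q -> bounded_above_at_minus_infinity (p (l - 1)%nat) ->
  (k <= l)%nat ->
  Rbar_locally p_infty
    (fun t => forall j, (j < k)%nat -> 0 <= p j t /\ 0 <= q j t).
Proof.
  intros Ch Bd. induction k as [|k IH]; intros Hk.
  - exists 0. intros t _ j Hj. lia.
  - destruct (q_eventually_positive l p q (l - 1 - k)) as (c & Hc & Ev); trivial; [lia|].
    replace (l - 1 - (l - 1 - k))%nat with k in Ev by lia.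
    assert (Evp : Rbar_locally p_infty (fun t => 0 <= p k t)).
    { apply (tends_to_infinity _ (q k) c); trivial. intros t. apply Ch. lia. }
    specialize (IH ltac:(lia)).
    destruct Ev as [T1 H1], Evp as [T2 H2], IH as [T3 H3].
    exists (Rmax T1 (Rmax T2 T3)). intros t Ht j Hj.
    pose proof (Rmax_l T1 (Rmax T2 T3)). pose proof (Rmax_r T1 (Rmax T2 T3)).
    pose proof (Rmax_l T2 T3). pose proof (Rmax_r T2 T3).
    destruct (Nat.eq_dec j k) as [-> |Hjk].
    + specialize (H1 t ltac:(lra)). specialize (H2 t ltac:(lra)). lra.
    + apply H3; [lra|lia].
Qed.

Lemma integrate_lower_bound (f f' : R -> R) (a h A : R) :
  (forall t, is_derive f t (f' t)) -> 0 < h -> 0 <= A -> 0 <= f a ->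
  (forall t, a <= t -> A <= f' t) ->
  forall t, a + h <= t -> h * A <= f t.
Proof.
  intros D Hh HA Ha H t Ht.
  pose proof (increment_ge f f' a t A D ltac:(lra)) as I.
  specialize (I ltac:(intros; apply H; lra)). nra.
Qed.

(** After time [s] the top function is at least [exp (p 0 s)]; each of the two
    integrations that lead from [p (k + 1)] to [p k] costs a delay [h] and
    a factor [h]. The condition [0 <= a] makes the weight [exp (2 t)] at least 1. *)
Lemma growth_step (l : nat) (p q : nat -> R -> R) (a s h : R) :
  (1 <= l)%nat -> log_radial_chain l p q -> 0 <= a -> a <= s -> 0 < h ->
  (forall t, a <= t -> forall j, (j < l)%nat -> 0 <= p j t /\ 0 <= q j t) ->
  forall i, (i <= l)%nat ->
  forall t, s + INR (2 * i) * h <= t -> h ^ (2 * i) * exp (p 0%nat s) <= p (l - i)%nat t.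
Proof.
  intros Hl (Dp & Dq & Top) Ha Hs Hh Pos i. induction i as [|i IH]; intros Hi t Ht.
  - rewrite Nat.mul_0_r in *. simpl in Ht. simpl pow. rewrite Rmult_1_l, Nat.sub_0_r.
    apply Rle_trans with (2 := Top t).
    pose proof (increment_ge (p 0%nat) (q 0%nat) s t 0) as I.
    specialize (I ltac:(intros; apply Dp; lia) ltac:(lra)).
    specialize (I ltac:(intros r Hr; apply Pos; [lra|lia])).
    destruct (Req_dec (p 0%nat s) (p 0%nat t)) as [-> |]; [apply Rle_refl|].
    apply Rlt_le, exp_increasing. lra.
  - set (b := s + INR (2 * i) * h).
    assert (Hb : s <= b).
    { unfold b. pose proof (pos_INR (2 * i)). nra. }
    set (A := h ^ (2 * i) * exp (p 0%nat s)) in *.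
    assert (HA : 0 <= A).
    { apply Rmult_le_pos; [apply pow_le; lra | apply Rlt_le, exp_pos]. }
    replace (2 * S i)%nat with (S (S (2 * i))) in * by lia.
    replace (h ^ S (S (2 * i)) * exp (p 0%nat s)) with (h * (h * A))
      by (unfold A; simpl; ring).
    rewrite !S_INR in Ht.
    assert (Hk : (l - S i < l)%nat) by lia.
    apply (integrate_lower_bound _ (q (l - S i)%nat) (b + h)); auto.
    + nra.
    + apply Pos; trivial. lra.
    + apply (integrate_lower_bound _ (fun t => exp (2 * t) * p (l - i)%nat t)); auto.
      * intros r. replace (l - i)%nat with (S (l - S i)) by lia. now apply Dq.
      * apply Pos; trivial. lra.
      * intros r Hr. specialize (IH ltac:(lia) r Hr).
        pose proof (exp_ineq1_le (2 * r)). nra.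
    + unfold b. lra.
Qed.

Theorem log_radial_chain_absurd (l : nat) (p q : nat -> R -> R) :
  (1 <= l)%nat -> log_radial_chain l p q ->
  ~ bounded_above_at_minus_infinity (p (l - 1)%nat).
Proof.
  intros Hl Ch Bd.
  destruct (all_eventually_nonneg l p q l Ch Bd (Nat.le_refl l)) as [T1 H1].
  destruct (q_eventually_positive l p q (l - 1)) as (c & Hc & Ev); trivial; [lia|].
  rewrite Nat.sub_diag in Ev.
  assert (Dp0 : forall t, is_derive (p 0%nat) t (q 0%nat t)).
  { intros t. apply Ch. lia. }
  destruct (tends_to_infinity (p 0%nat) (q 0%nat) c Dp0 Hc Ev
              (2 * (INR (2 * l) + 1))) as [T2 H2].
  set (a := Rmax 0 (Rmax T1 T2) + 1).
  pose proof (Rmax_l 0 (Rmax T1 T2)). pose proof (Rmax_r 0 (Rmax T1 T2)).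
  pose proof (Rmax_l T1 T2). pose proof (Rmax_r T1 T2).
  assert (Pos : forall t, a <= t -> forall j, (j < l)%nat -> 0 <= p j t /\ 0 <= q j t).
  { intros t Ht. apply H1. unfold a in Ht. lra. }
  apply (Rle_not_lt _ _ (H2 a ltac:(unfold a; lra))).
  apply no_accelerating_growth.
  - intros s t Hs Hst.
    pose proof (increment_ge (p 0%nat) (q 0%nat) s t 0 Dp0 Hst) as I.
    specialize (I ltac:(intros r Hr; apply Pos; [lra|lia])). lra.
  - intros s h Hs Hh.
    pose proof (growth_step l p q a s h Hl Ch ltac:(unfold a; lra) Hs Hh Pos
                  l (Nat.le_refl l)) as G.
    rewrite Nat.sub_diag in G. apply G. lra.
Qed.

(** * Entire solutions *)

(** The circle means of [Delta^k u], for [k] up to [l], would form a chain of the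
    kind just excluded; continuity of [Delta^(l-1) u] at the origin gives the
    bound at minus infinity. *)
Theorem no_entire_solution (l : nat) (hl : (1 <= l)%nat) (u : R -> R -> R) :
  ~ classical_entire_solution l exp u.
Proof.
  intros [Hu Heq].
  set (g := fun k => iter_laplacian k u).
  assert (Cg : forall k, (k <= l)%nat -> class_C (2 * (l - k)) (g k)).
  { intros k Hk. now apply class_C_iter_laplacian. }
  assert (Cg2 : forall k, (k < l)%nat -> class_C (S (S (2 * (l - S k)))) (g k)).
  { intros k Hk. replace (S (S (2 * (l - S k)))) with (2 * (l - k))%nat by lia.
    apply Cg. lia. }
  apply (log_radial_chain_absurd l (fun k => circle_mean (g k))
           (fun k => circle_mean (radial (dx (g k)) (dy (g k)))) hl).
  2:{ apply circle_mean_bounded_above. eapply class_C_continuous, Cg. lia. }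
  split; [|split].
  - intros k t Hk. eapply is_derive_circle_mean, class_C_C1, Cg2, Hk.
  - intros k t Hk. specialize (Cg2 k Hk).
    apply (is_derive_circle_mean_radial _ _ (dx (dx (g k))) (dy (dx (g k)))
             (dx (dy (g k))) (dy (dy (g k)))).
    + eapply class_C_C1, class_C_dx, Cg2.
    + eapply class_C_C1, class_C_dy, Cg2.
  - intros t. rewrite (circle_mean_ext (g l) (fun x y => exp (u x y))) by apply Heq.
    apply exp_circle_mean_le. eapply class_C_continuous, Hu.
Qed.

Theorem corollary2p1 (m : nat) (hm : (1 <= m)%nat) :
  ~ exists u : R -> R -> R, classical_entire_solution (2 * m) exp u.
Proof.
  intros [u Hu]. apply (no_entire_solution (2 * m) ltac:(lia) u Hu).
Qed.
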